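(* Let $K$ be an infinite field and let $f\in K\langle X\rangle$ be a multilinear polynomial. Then the image of $f$ on $UT_n(K)$ is $J^r$ if and only if $f$ has commutator-degree $r$.
   Context: All algebras are associative. $K\langle X\rangle$ is the free associative algebra over $K$ freely generated by a set $X=\{x_1,x_2,\dots\}$ of noncommutative variables. A polynomial $f(x_1,\dots,x_m)\in K\langle X\rangle$ is multilinear if it is multihomogeneous of multidegree $(1,\dots,1)$, i.e. $f=\sum_{\sigma\in S_m}\alpha_\sigma x_{\sigma(1)}\cdots x_{\sigma(m)}$ with $\alpha_\sigma\in K$. For an algebra $A$ over $K$, the image of $f$ on $A$ is the set $f(A)=\{f(a_1,\dots,a_m): a_1,\dots,a_m\in A\}$. $UT_n(K)$ is the algebra of $n\times n$ upper triangular matrices over $K$, and $J$ is its Jacobson radical, which is the ideal of strictly upper triangular matrices. For $r\in\{1,\dots,n\}$, the power $J^r$ is the linear span of all matrix units $E_{i,j}$ with $j-i\ge r$ (so $J^n=\{0\}$), and by convention $J^0=UT_n(K)$. A T-ideal of $K\langle X\rangle$ is an ideal invariant under all endomorphisms of the algebra $K\langle X\rangle$; $\langle\mathcal F\rangle^T$ denotes the smallest T-ideal containing $\mathcal F$. Write $[x,y]=xy-yx$. A polynomial $f\in K\langle X\rangle$ has commutator-degree $r$ (for $r\ge 1$) if $f\in\langle [x_1,x_2][x_3,x_4]\cdots[x_{2r-1},x_{2r}]\rangle^T$ and $f\notin\langle [x_1,x_2][x_3,x_4]\cdots[x_{2r+1},x_{2r+2}]\rangle^T$; it has commutator-degree $0$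 if $f\notin\langle[x_1,x_2]\rangle^T$.
   Formalization: For r = n only ''commutator-degree n implies image J^n = {0}'' is claimed, since the converse fails (f = 0, or a product of n+1 commutators in distinct variables); f has degree m ≥ 1, as a nonzero constant has commutator-degree 0 but image {cI}. *)

(* Defs.v *)
From HB Require Import structures.
From mathcomp Require Import all_boot all_fingroup all_algebra all_field.
From mathcomp Require Export monalg.

Set Implicit Arguments.
Unset Strict Implicit.
Unset Printing Implicit Defensive.

Import GRing.Theory.
Local Open Scope ring_scope.

Definition infinite_field (K : fieldType) : Prop :=
  forall s : seq K, exists x, x \notin s.

(* K<X>: the monoid algebra of the free monoid on countably many letters;
   the letter i : nat stands for the variable x_(i+1). *)
Notation freealg K := {malg K[{fmonom nat}]}.

Definition fvar (K : fieldType) (i : nat) : freealg K := mkmalgU (fmu i) 1.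

Section FreeAlgebra.
Variable K : fieldType.
Implicit Types (f p q : freealg K) (I : freealg K -> Prop).

(* Degree 0 is excluded by hypothesis where this predicate is used; the zero
   polynomial is multilinear. *)
Definition multilinear (m : nat) f : Prop :=
  exists alpha : 'S_m -> K,
    f = \sum_(s : 'S_m) alpha s *: \prod_(i < m) fvar K (s i).

(* The value of f under x_(i+1) |-> a i. *)
Definition feval (A : lalgType K) (a : nat -> A) f : A :=
  mmap (fun c : K => c%:A) (fun w : {fmonom nat} => \prod_(i <- w) a i) f.

Definition T_ideal I : Prop :=
  [/\ I 0,
      forall p q, I p -> I q -> I (p + q),
      forall p q, I q -> I (p * q) /\ I (q * p)
    & forall (phi : {lrmorphism freealg K -> freealg K}) p, I p -> I (phi p)].

Definition T_ideal_gen (F : freealg K -> Prop) p : Prop :=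
  forall I, T_ideal I -> (forall q, F q -> I q) -> I p.

(* [x_1, x_2] [x_3, x_4] ... [x_(2r-1), x_(2r)] *)
Definition commutator_prod (r : nat) : freealg K :=
  \prod_(i < r) (fvar K i.*2 * fvar K i.*2.+1 - fvar K i.*2.+1 * fvar K i.*2).

Definition in_commutator_T_ideal (r : nat) f : Prop :=
  T_ideal_gen (fun q => q = commutator_prod r) f.

Definition commutator_degree (r : nat) f : Prop :=
  ((0 < r)%N -> in_commutator_T_ideal r f) /\ ~ in_commutator_T_ideal r.+1 f.

End FreeAlgebra.

(* Matrices have size n.+1, so that they form a nonzero unital algebra. *)
Section UpperTriangular.
Variables (K : fieldType) (n : nat).
Implicit Types (A B M : 'M[K]_n.+1) (r : nat).

Definition unit_span r : {vspace 'M[K]_n.+1} :=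
  (\sum_(ij : 'I_n.+1 * 'I_n.+1 | (ij.1 + r <= ij.2)%N)
     <[delta_mx ij.1 ij.2]>)%VS.

Definition UT : {vspace 'M[K]_n.+1} := unit_span 0.

Definition UT_rad : {vspace 'M[K]_n.+1} := unit_span 1.

(* The library's zeroth power of a subspace is the line of scalars, whereas the
   zeroth power of the radical is by convention the whole algebra. *)
Definition UT_rad_pow r : {vspace 'M[K]_n.+1} :=
  if r is 0 then UT else (UT_rad ^+ r)%VS.

(* The assignment covers every variable; for f multilinear in x_1, ..., x_m only
   the values at x_1, ..., x_m matter. *)
Definition UT_image (f : freealg K) M : Prop :=
  exists a : nat -> 'M[K]_n.+1, (forall i, a i \in UT) /\ M = feval a f.

Lemma mem_unit_span r A :
  reflect (forall i j : 'I_n.+1, (j < i + r)%N -> A i j = 0)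
          (A \in unit_span r).
Proof.
apply: (iffP idP) => [/memv_sumP[B hB ->] i j lt_ji | hA].
  rewrite summxE big1 // => -[k l] /= le_kl.
  have /vlineP[c ->] := hB (k, l) le_kl; rewrite !mxE /=.
  case: eqP => [eik|_]; last by rewrite mulr0.
  case: eqP => [ejl|_]; last by rewrite mulr0.
  by move: lt_ji; rewrite eik ejl ltnNge le_kl.
rewrite [A]matrix_sum_delta pair_big /=.
apply: memv_suml => -[i j] _ /=.
have [lt_ji|le_ij] := ltnP j (i + r); first by rewrite hA // scale0r mem0v.
by rewrite memvZ // memvE (sumv_sup (i, j)).
Qed.

Lemma mem_UT A : (A \in UT) = is_trig_mx A^T.
Proof.
apply/mem_unit_span/is_trig_mxP => hA i j ij.
  by rewrite mxE hA // addn0.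
by have := hA j i; rewrite mxE; apply; rewrite addn0 in ij.
Qed.

Lemma UT_rad_powE r : UT_rad_pow r = unit_span r.
Proof.
case: r => [|r] //=; elim: r => [|r IHr]; first exact: expv1.
rewrite expvSl IHr; apply/eqP; rewrite eqEsubv; apply/andP; split.
  apply/prodvP => A B /mem_unit_span hA /mem_unit_span hB.
  apply/mem_unit_span => i j lt_ji.
  rewrite mxE big1 // => k _.
  have [lt_k|le_k] := ltnP k (i + 1); first by rewrite hA // mul0r.
  rewrite hB ?mulr0 //; apply: leq_trans lt_ji _.
  by rewrite -[r.+2]add1n addnA leq_add2r.
apply/subv_sumP => -[i j] /= le_ij.
have lt_i : (i.+1 < n.+1)%N.
  by apply: leq_ltn_trans (ltn_ord j); apply: leq_trans le_ij;
     rewrite addnS ltnS leq_addr.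
rewrite -memvE -(mul_delta_mx (Ordinal lt_i)).
apply: memv_mul; rewrite memvE.
  by apply: (sumv_sup (i, Ordinal lt_i)); rewrite //= addn1.
by apply: (sumv_sup (Ordinal lt_i, j)); rewrite //= addSn -addnS.
Qed.

End UpperTriangular.

(* Main.v *)
Require Import Defs.
From HB Require Import structures.
From mathcomp Require Import all_boot all_fingroup all_algebra.
From mathcomp Require Import finmap.
From Stdlib Require Import Classical.

(** Write J for the radical of the algebra of upper triangular matrices of size
    N = n + 1, and T_r for the T-ideal of the product of r commutators. On
    triangular matrices T_r takes its values in J^r. For f in T_d but not in
    T_(d+1), with d < N, the image is all of J^d; since the powers J^0, ..., J^N
    are distinct and every polynomial outside T_r has such a d below r, this
    gives both directions.

    What f does on triangular matrices is read off from homogeneous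
    substitutions, which send each letter s to a matrix supported on a single
    diagonal, the e s-th one. Such matrices move a basis row vector to a
    multiple of a basis row vector, so a word acts through a product of
    coefficients, its weight.

    The first main point is that a multilinear f is in T_(d+1) as soon as all
    homogeneous substitutions with total step at most d give 0
    (low_vanish_comm_power). Sorting ever longer heads of the words writes f,
    up to a multiple of the ordered word, as a sum of products of a difference
    b x - sort (b x) and a polynomial f_(b,x) in the letters other than b, x. By
    descending induction on the length of b, a substitution that reads the
    letters of b in row 0 and lets x step from row 0 to row 1 isolates f_(b,x)
    (tails_low_vanish): it inherits the vanishing condition with one step
    fewer, and induction on d applies.

    So if f is in T_d but not in T_(d+1), some homogeneous substitution with
    total step d gives a nonzero value. For d = 0 the sum of the coefficients
    of f is nonzero, and all matrices but one can be set to 1. For d > 0 a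
    letter z makes the first step out of row 0. Fix homogeneous matrices for the
    other letters and let the matrix for z vary: f becomes a linear
    endomorphism of J^d, up to a shift of columns. It is triangular with respect
    to rows, because rows never decrease along a word. Its diagonal coefficients
    come from the words in which z makes the first step: up to a relabelling of
    rows they are the nonzero value found above, and for generic matrices at the
    other letters none of them is zero (line_poly_common, where K is infinite).
    Hence the endomorphism is injective, so it is onto J^d (jump_image). *)

Set Implicit Arguments.
Unset Strict Implicit.
Unset Printing Implicit Defensive.

Import GRing.Theory.
Local Open Scope ring_scope.

(** * Evaluation of noncommutative polynomials *)

Section Evaluation.
Variables (K : fieldType) (A : lalgType K) (a : nat -> A).

Let word_value (w : {fmonom nat}) : A := \prod_(i <- w) a i.

Fact word_value_is_mmorphism : mmorphism word_value.
Proof.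
split=> [u v|]; rewrite /word_value; first by rewrite fmM big_cat.
by rewrite fm1 big_nil.
Qed.

#[local] HB.instance Definition _ :=
  monalg.isMultiplicative.Build {fmonom nat} A word_value
    word_value_is_mmorphism.

Fact feval_is_zmod_morphism : zmod_morphism (feval a).
Proof. exact: (@mmap_is_additive _ _ _ (in_alg A) word_value). Qed.

HB.instance Definition _ :=
  GRing.isZmodMorphism.Build (freealg K) A (feval a) feval_is_zmod_morphism.

Fact feval_is_scalable : scalable (feval a).
Proof.
move=> c p; rewrite -[RHS]mulr_algl.
exact: (@mmapZ _ _ _ (in_alg A) word_value).
Qed.

HB.instance Definition _ :=
  GRing.isScalable.Build K (freealg K) A *:%R (feval a) feval_is_scalable.

Lemma feval_fvar i : feval a (fvar K i) = a i.
Proof.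
rewrite /feval /fvar (@mmapU _ _ _ (in_alg A)) /= scale1r mul1r.
by rewrite fmuE big_seq1.
Qed.

Fact feval_is_monoid_morphism :
  (forall (c : K) (x : A), c *: x = x * c%:A) -> monoid_morphism (feval a).
Proof.
move=> central.
have [] := @commr_mmap_is_multiplicative _ _ _ (in_alg A) word_value.
  by move=> g u v; rewrite /GRing.comm /= mulr_algl central.
by move=> hM h1; split.
Qed.

End Evaluation.

Fact feval_alg_is_monoid_morphism (K : fieldType) (A : algType K)
  (a : nat -> A) : monoid_morphism (feval a).
Proof. by apply: feval_is_monoid_morphism => c x; rewrite mulr_algr. Qed.

HB.instance Definition _ (K : fieldType) (A : algType K) (a : nat -> A) :=
  GRing.isMonoidMorphism.Build (freealg K) A (feval a)
    (feval_alg_is_monoid_morphism a).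

Section Substitution.
Variable K : fieldType.
Implicit Types p q : freealg K.

Lemma freealg_scaleAr (c : K) p : c *: p = p * c%:A.
Proof.
rewrite -[LHS]mul_malgC -[c%:A]mul_malgC mulr1 [LHS]malgM_def [RHS]malgM_def.
by rewrite fgmulUg fgmulgU; apply: eq_bigr => w _; rewrite mul1m mulm1 mulrC.
Qed.

Lemma freealg_scalerAr (c : K) p q : c *: (p * q) = p * (c *: q).
Proof.
rewrite [LHS]freealg_scaleAr -mulrA; congr (p * _).
by rewrite [RHS]freealg_scaleAr.
Qed.

(** For values in an algebra, evaluation is multiplicative because scalars are
    central by definition. In the free algebra centrality is a property of the
    convolution product, so substitution is a morphism in its own right. *)
Definition subst_vars (a : nat -> freealg K) : freealg K -> freealg K :=
  feval a.

HB.instance Definition _ a := GRing.Linear.on (subst_vars a).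
HB.instance Definition _ a :=
  GRing.isMonoidMorphism.Build (freealg K) (freealg K) (subst_vars a)
    (feval_is_monoid_morphism a freealg_scaleAr).

Lemma subst_vars_fvar a i : subst_vars a (fvar K i) = a i.
Proof. exact: feval_fvar. Qed.

Lemma prod_fvar (s : seq nat) :
  \prod_(i <- s) fvar K i = mkmalgU (fmonom_of_seq fmonom_key s) 1.
Proof.
elim: s => [|i s IHs]; first by rewrite big_nil.
rewrite big_cons IHs malgM_def fgmulUU mulr1; congr mkmalgU.
by rewrite /mmul /= fmmulE fmuE !fmE.
Qed.

Lemma freealg_sum_words p :
  p = \sum_(w <- msupp p) p@_w *: \prod_(i <- (w : seq nat)) fvar K i.
Proof.
rewrite [LHS]monalgE; apply: eq_bigr => w _.
rewrite prod_fvar fmE malgZ_def [in RHS]/fgscale msuppU1 big_seq_fset1.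
by rewrite mcoeffUU mulr1; case: w.
Qed.

End Substitution.

(** * Powers of the commutator ideal *)

Section Commutator.
Variable R : pzRingType.
Implicit Types p q u v x c d : R.

Definition commutator p q := p * q - q * p.

Lemma commutator_mulr p q u :
  commutator p q * u = commutator p (q * u) - q * commutator p u.
Proof. by rewrite /commutator mulrBl mulrBr !mulrA opprB addrA subrK. Qed.

Lemma commutator_pull_front x p q u :
  x * (p - q * u) + 1 * commutator x q * u = x * p - q * (x * u).
Proof. by rewrite mul1r /commutator mulrBr mulrBl !mulrA addrA subrK. Qed.

Lemma commutator_insert p c d u v :
  p * commutator c d * u * v =
  p * commutator c (d * u) * v + p * - d * (commutator c u * v).
Proof.
rewrite -[_ * u]mulrA commutator_mulr mulrBr mulrBl.
by rewrite mulrN mulNr !mulrA.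
Qed.

End Commutator.

Lemma rmorph_commutator (R S : pzRingType) (f : {rmorphism R -> S}) p q :
  f (commutator p q) = commutator (f p) (f q).
Proof. by rewrite rmorphB !rmorphM. Qed.

Section CommutatorIdeal.
Variable K : fieldType.
Implicit Types (p q u : freealg K) (k : nat).

(** The k-th power of the ideal generated by all commutators, in a form suited
    to induction on k: the span of the u_0[a_1,b_1]u_1...[a_k,b_k]u_k. *)
Inductive comm_power : nat -> freealg K -> Prop :=
| Comm_power_all p : comm_power 0 p
| Comm_power_zero k : comm_power k 0
| Comm_power_add k p q :
    comm_power k p -> comm_power k q -> comm_power k (p + q)
| Comm_power_step k u p q v :
    comm_power k v -> comm_power k.+1 (u * commutator p q * v).

Lemma comm_power_mull k u p : comm_power k p -> comm_power k (u * p).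
Proof.
elim=> {k p} [p|k|k p q _ IHp _ IHq|k w p q v hv _].
- exact: Comm_power_all.
- by rewrite mulr0; apply: Comm_power_zero.
- by rewrite mulrDr; apply: Comm_power_add.
- by rewrite !mulrA; apply: Comm_power_step.
Qed.

Lemma comm_power_sum k (I : Type) (r : seq I) (P : pred I)
    (F : I -> freealg K) :
  (forall i, P i -> comm_power k (F i)) ->
  comm_power k (\sum_(i <- r | P i) F i).
Proof.
move=> hF; apply: big_ind => // [|p q]; first exact: Comm_power_zero.
exact: Comm_power_add.
Qed.

Lemma comm_power1_mul k p q :
  comm_power 1 p -> comm_power k q -> comm_power k.+1 (p * q).
Proof.
move=> hp hq; suff gen k1 : comm_power k1 p -> k1 = 1%N ->
    comm_power k.+1 (p * q) by exact: gen hp erefl.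
elim=> {p hp k1} [p|k1|k1 p r _ IHp _ IHr|k1 u p r v _ _].
- by move=> /eqP.
- by move=> _; rewrite mul0r; apply: Comm_power_zero.
- by move=> E1; rewrite mulrDl; apply: Comm_power_add; [apply: IHp|apply: IHr].
- move=> _; rewrite -mulrA; apply: Comm_power_step.
  exact: comm_power_mull.
Qed.

(** Pulling a letter to the front of a word costs a multiple of one
    commutator, with the product of the letters that it jumps over. *)
Lemma comm_power1_perm (s1 s2 : seq nat) : perm_eq s1 s2 ->
  comm_power 1 (\prod_(i <- s1) fvar K i - \prod_(i <- s2) fvar K i).
Proof.
elim: s1 s2 => [|x s1 IHs] s2.
  by rewrite perm_sym => /perm_nilP ->; rewrite subrr; apply: Comm_power_zero.
move=> p12; have x_s2 : x \in s2 by rewrite -(perm_mem p12) mem_head.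
case/splitPr: x_s2 p12 => u v p12.
have {}p12 : perm_eq s1 (u ++ v).
  by rewrite -(perm_cons x) (permPl p12) -cat_rcons -cats1 -catA perm_catCA.
rewrite big_cons !big_cat big_cons -commutator_pull_front.
apply: Comm_power_add; last first.
  by apply: Comm_power_step; apply: Comm_power_all.
by apply: comm_power_mull; rewrite -big_cat; apply: IHs.
Qed.

Definition comm_seq (s : seq (freealg K * freealg K)) : freealg K :=
  \prod_(c <- s) commutator c.1 c.2.

Lemma comm_seq0 p : comm_seq [::] * p = p.
Proof. by rewrite /comm_seq big_nil; apply: mul1r. Qed.

Lemma comm_seq_rcons s c d :
  comm_seq (rcons s (c, d)) = comm_seq s * commutator c d.
Proof. by rewrite /comm_seq -cats1 big_cat big_seq1. Qed.

(** A factor u standing between two commutators can be absorbed, because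
    [a,b]u = [a,bu] - b[a,u]: this moves u one commutator to the left, and
    finally to the front of the product. *)
Lemma comm_seq_insert (I : freealg K -> Prop) (T_I : T_ideal I) k p :
    (forall s, size s = k -> I (comm_seq s * p)) ->
  forall s u, size s = k -> I (comm_seq s * u * p).
Proof.
case: T_I => [_ ID IM _]; elim: k p => [|k IHk] p hp s u.
  move=> /size0nil ->; rewrite -mulrA comm_seq0.
  suff Ip : I p by exact: (IM u p Ip).1.
  by rewrite -[p]comm_seq0; apply: hp.
case/lastP: s => [|s [a b]] //; rewrite size_rcons => -[sz_s].
rewrite comm_seq_rcons commutator_insert; apply: ID.
  by rewrite -comm_seq_rcons; apply: hp; rewrite size_rcons sz_s.
apply: IHk => // s' sz_s'; rewrite mulrA -comm_seq_rcons.
by apply: hp; rewrite size_rcons sz_s'.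
Qed.

(** A substitution turns the product of commutators of distinct letters into a
    product of arbitrary commutators; the factors between these are then
    absorbed from left to right. *)
Lemma comm_power_T_ideal k p : comm_power k p -> in_commutator_T_ideal k p.
Proof.
move=> hp I T_I /(_ _ erefl) Ik; case: (T_I) => [I0 ID IM IS].
have Ik_seq s : size s = k -> I (comm_seq s).
  move=> sz_s; pose a i := if odd i then (nth (0, 0) s i./2).2
                           else (nth (0, 0) s i./2).1.
  suff <- : subst_vars a (commutator_prod K k) = comm_seq s by apply: IS.
  rewrite rmorph_prod /comm_seq (big_nth (0, 0)) sz_s big_mkord.
  apply: eq_bigr => i _; rewrite [LHS]rmorph_commutator.
  rewrite [X in commutator X]subst_vars_fvar.
  rewrite [X in commutator _ X]subst_vars_fvar.
  by rewrite /a oddS odd_double doubleK -[_.+1./2]/(uphalf _) uphalf_double.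
suff gen j q : comm_power j q ->
    forall i s, (i + j = k)%N -> size s = i -> I (comm_seq s * q).
  by rewrite -[p]comm_seq0; apply: (gen _ _ hp 0%N).
elim=> {j q} [q|j|j q1 q2 _ IH1 _ IH2|j u a b q _ IHq] i s ij sz_s.
- have Is : I (comm_seq s) by apply: Ik_seq; rewrite sz_s -ij addn0.
  exact: (IM q _ Is).2.
- by rewrite mulr0.
- by rewrite mulrDr; apply: ID; [exact: (IH1 i s)|exact: (IH2 i s)].
rewrite -[u * _ * q]mulrA [_ * (u * _)]mulrA.
apply: (comm_seq_insert T_I (k := i)) => // s' sz_s'.
rewrite mulrA -comm_seq_rcons; apply: (IHq i.+1); first by rewrite addSnnS.
by rewrite size_rcons sz_s'.
Qed.

Lemma in_commutator_T_ideal0 p : in_commutator_T_ideal 0 p.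
Proof. by apply: comm_power_T_ideal; apply: Comm_power_all. Qed.

End CommutatorIdeal.

(** * Values of the commutator ideals on upper triangular matrices *)

Section RadicalValues.
Variables (K : fieldType) (n : nat).
Implicit Types (A B : 'M[K]_n.+1) (r s : nat).

Lemma unit_spanM r s A B :
  A \in unit_span K n r -> B \in unit_span K n s ->
  A * B \in unit_span K n (r + s).
Proof.
move=> /mem_unit_span hA /mem_unit_span hB; apply/mem_unit_span => i j lt_ji.
rewrite mxE big1 // => k _; have [lt_k|le_k] := ltnP k (i + r).
  by rewrite hA // mul0r.
rewrite hB ?mulr0 //; apply: leq_trans lt_ji _.
by rewrite addnA leq_add2r.
Qed.

Lemma unit_span1 : (1 : 'M[K]_n.+1) \in unit_span K n 0.
Proof.
apply/mem_unit_span => i j; rewrite addn0 mxE => lt_ji.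
by rewrite -val_eqE /= gtn_eqF.
Qed.

Lemma unit_span_prod (I : eqType) (w : seq I) (F : I -> 'M[K]_n.+1) :
  (forall i, i \in w -> F i \in unit_span K n 0) ->
  \prod_(i <- w) F i \in unit_span K n 0.
Proof.
move=> hF; rewrite big_seq; elim/big_ind: _ => //; first exact: unit_span1.
by move=> x y; apply: (@unit_spanM 0 0).
Qed.

(** On the diagonal, triangular matrices multiply entrywise, hence
    commute. *)
Lemma unit_span_comm A B :
  A \in unit_span K n 0 -> B \in unit_span K n 0 ->
  A * B - B * A \in unit_span K n 1.
Proof.
move=> hA hB; have /mem_unit_span hAB := unit_spanM hA hB.
have /mem_unit_span hBA := unit_spanM hB hA.
have subE (C D : 'M[K]_n.+1) i j : (C - D) i j = C i j - D i j by rewrite !mxE.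
apply/mem_unit_span => i j; rewrite addn1 ltnS leq_eqVlt => /orP[/eqP eji|].
  have {}eji : j = i by apply: val_inj.
  have diag (C D : 'M[K]_n.+1) : C \in unit_span K n 0 ->
      D \in unit_span K n 0 -> (C * D) i i = C i i * D i i.
    move=> /mem_unit_span hC /mem_unit_span hD; rewrite mxE (bigD1 i) //=.
    rewrite big1 ?addr0 // => k; rewrite -val_eqE neq_ltn => /orP[lt|lt].
      by rewrite hC ?addn0 // mul0r.
    by rewrite hD ?addn0 // mulr0.
  by rewrite eji subE !diag // [B i i * _]mulrC subrr.
by move=> lt_ji; rewrite subE hAB ?hBA ?subrr // !addn0.
Qed.

Lemma feval_UT (a : nat -> 'M[K]_n.+1) p :
  (forall i, a i \in unit_span K n 0) -> feval a p \in unit_span K n 0.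
Proof.
move=> ha; rewrite /feval /mmap; apply: memv_suml => w _.
by rewrite mulr_algl memvZ // unit_span_prod.
Qed.

(** Both sides are algebra morphisms with the same values on the letters; this
    turns closure of a value condition under substitution into a change of the
    matrices. *)
Lemma feval_comp (a : nat -> 'M[K]_n.+1)
    (phi : {lrmorphism freealg K -> freealg K}) p :
  feval a (phi p) = feval (fun i => feval a (phi (fvar K i))) p.
Proof.
rewrite [in LHS](freealg_sum_words p) [in RHS](freealg_sum_words p) !linear_sum.
apply: eq_bigr => w _; rewrite !linearZ /=; congr (_ *: _).
rewrite !rmorph_prod; apply: eq_bigr => i _.
by rewrite /= feval_fvar.
Qed.

(** A product of r commutators of triangular matrices lies in the r-th power of
    the radical, and the polynomials with all values there form a T-ideal. *)
Lemma feval_commutator_T_ideal r p (a : nat -> 'M[K]_n.+1) :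
  in_commutator_T_ideal r p -> (forall i, a i \in unit_span K n 0) ->
  feval a p \in unit_span K n r.
Proof.
move=> hp; pose I p := forall a : nat -> 'M[K]_n.+1,
  (forall i, a i \in unit_span K n 0) -> feval a p \in unit_span K n r.
move: a; apply: (hp I) => {p hp} [|p -> a ha].
  split=> [a _|p q hp hq a ha|p q hq|phi p hp a ha].
  - by rewrite raddf0 mem0v.
  - by rewrite raddfD memvD ?hp ?hq.
  - have [pUT qr] : (forall a, (forall i, a i \in unit_span K n 0) ->
      feval a p \in unit_span K n 0) /\ I q by split=> // a; apply: feval_UT.
    split=> a ha; rewrite rmorphM.
      by rewrite -[r]add0n unit_spanM ?pUT ?qr.
    by rewrite -[r]addn0 unit_spanM ?pUT ?qr.
  - by rewrite feval_comp; apply: hp => i; apply: feval_UT.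
rewrite /commutator_prod; elim: r {I} => [|r IHr].
  by rewrite big_ord0 rmorph1 unit_span1.
rewrite big_ord_recr rmorphM; have := @unit_spanM r 1; rewrite addn1.
apply=> //; rewrite [X in X \in _]rmorph_commutator.
by apply: unit_span_comm; rewrite [X in X \in _]feval_fvar.
Qed.

End RadicalValues.

(** * Homogeneous substitutions *)

Section Weights.
Variable K : fieldType.
Implicit Types (e : nat -> nat) (t : nat -> nat -> K) (w : seq nat).

(** The letter s stands for the operator that maps the row vector e_i to
    t s i *: e_(i + e s); a word then maps e_i to a multiple of a basis vector,
    and this is the multiple. *)
Fixpoint weight e t (i : nat) w : K :=
  if w is s :: w' then t s i * weight e t (i + e s)%N w' else 1.

Lemma weight_cat e t i u v :
  weight e t i (u ++ v) =
  weight e t i u * weight e t (i + \sum_(s <- u) e s)%N v.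
Proof.
elim: u i => [|s u IHu] i /=; first by rewrite big_nil addn0 mul1r.
by rewrite IHu big_cons addnA mulrA.
Qed.

Lemma weight_rcons e t i u y :
  weight e t i (rcons u y) = weight e t i u * t y (i + \sum_(s <- u) e s)%N.
Proof. by rewrite -cats1 weight_cat /= mulr1. Qed.

Lemma weight_eq0 e t i w y :
  y \in w -> (forall j, (i <= j)%N -> t y j = 0) -> weight e t i w = 0.
Proof.
elim: w i => //= s w IHw i; rewrite inE => /orP[/eqP <-|yw] hy.
  by rewrite hy // mul0r.
rewrite IHw ?mulr0 // => j le_j; apply: hy; apply: leq_trans le_j.
exact: leq_addr.
Qed.

(** Only the rows from i on can be reached, so a relabelling of these rows by
    an additive shift preserves the weight. *)
Lemma weight_shift e t e' t' d i w :
    {in w, forall s, e' s = e s /\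
       (forall j, (i <= j)%N -> t' s (d + j)%N = t s j)} ->
  weight e' t' (d + i)%N w = weight e t i w.
Proof.
elim: w i => //= s w IHw i h; have [-> ht] := h s (mem_head _ _).
rewrite ht // -addnA IHw // => y yw.
have [-> hy] := h y (mem_behead (s := s :: w) yw).
by split=> // j le_j; apply: hy; apply: leq_trans le_j; apply: leq_addr.
Qed.

Lemma weight_diag e t i w :
  {in w, forall s, e s = 0%N} -> weight e t i w = \prod_(s <- w) t s i.
Proof.
elim: w => [|s w IHw] h /=; first by rewrite big_nil.
rewrite big_cons h ?mem_head // addn0 IHw // => y yw.
by apply: h; rewrite inE yw orbT.
Qed.

Definition step_mx n e t s : 'M[K]_n.+1 :=
  \matrix_(i, j) (t s i *+ (j == (i + e s)%N :> nat)).

Lemma step_mx_UT n e t s : step_mx n e t s \in unit_span K n 0.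
Proof.
apply/mem_unit_span => i j; rewrite addn0 mxE => lt_ji.
by rewrite ltn_eqF // (leq_trans lt_ji) ?leq_addr.
Qed.

(** Steps never decrease the row, so a word that leaves the range of rows does
    not come back: the product vanishes, and so does the right-hand side. *)
Lemma prod_step_mx n e t w (i j : 'I_n.+1) :
  (\prod_(s <- w) step_mx n e t s) i j =
  weight e t i w *+ (j == (i + \sum_(s <- w) e s)%N :> nat).
Proof.
elim: w i => [|s w IHw] i /=.
  by rewrite !big_nil addn0 mxE eq_sym.
rewrite !big_cons mxE addnA.
have [lt_n|le_n] := ltnP (i + e s) n.+1.
  rewrite (bigD1 (Ordinal lt_n)) //= [X in _ + X]big1 ?addr0 => [|k ne_k].
    by rewrite IHw mxE /= eqxx mulr1n mulrnAr.
  by rewrite mxE (_ : (k == _ :> nat) = false) ?mul0r //; apply/negbTE.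
rewrite big1 => [|k _]; last first.
  rewrite mxE (_ : (k == _ :> nat) = false) ?mul0r //.
  by rewrite ltn_eqF // (leq_trans _ le_n).
rewrite (_ : (j == _ :> nat) = false) // ltn_eqF // (leq_trans (ltn_ord j)) //.
exact: leq_trans le_n (leq_addr _ _).
Qed.

End Weights.

(** * Multilinear identities of triangular matrices *)

Section WordSums.
Variable K : fieldType.
Implicit Types (e : nat -> nat) (t : nat -> nat -> K) (w S : seq nat).
Implicit Types (l : seq (K * seq nat)) (p q k : nat).

Definition word_sum l : freealg K :=
  \sum_(c <- l) c.1 *: \prod_(s <- c.2) fvar K s.

Definition value e t i l : K := \sum_(c <- l) c.1 * weight e t i c.2.

Lemma feval_word_sum (A : algType K) (a : nat -> A) l :
  feval a (word_sum l) = \sum_(c <- l) c.1 *: \prod_(s <- c.2) a s.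
Proof.
rewrite linear_sum; apply: eq_bigr => c _; rewrite linearZ /=; congr (_ *: _).
by rewrite rmorph_prod; apply: eq_bigr => i _; rewrite /= feval_fvar.
Qed.

(** A multilinear polynomial is handled as a list of coefficients and words,
    with repetitions allowed, so that lists can be cut and regrouped freely. *)
Definition words_on S l := forall c, c \in l -> perm_eq c.2 S.

Lemma feval_step_mx n e t S l (i j : 'I_n.+1) : words_on S l ->
  feval (step_mx n e t) (word_sum l) i j =
  value e t i l *+ (j == (i + \sum_(s <- S) e s)%N :> nat).
Proof.
move=> hl; rewrite feval_word_sum summxE -sumrMnl big_seq [RHS]big_seq.
apply: eq_bigr => c /hl pS; rewrite mxE prod_step_mx -mulrnAr.
by rewrite (perm_big _ pS).
Qed.

(** On S-multilinear words the substitution by e and t moves every row by the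
    same amount, the total step over S. Row 0 suffices, because t is
    arbitrary. *)
Definition low_vanish k S l :=
  forall e t, (\sum_(s <- S) e s < k)%N -> value e t 0 l = 0.

Lemma low_vanish_row k S l e t i : low_vanish k S l ->
  (\sum_(s <- S) e s < k)%N -> value e t i l = 0.
Proof.
move=> hl lt_k; rewrite -[RHS](hl e (fun s j => t s (i + j)%N) lt_k).
apply: eq_bigr => c _; congr (_ * _).
by rewrite -[i in LHS]addn0; apply: weight_shift => s _.
Qed.

End WordSums.

Lemma sort_leq_perm (s1 s2 : seq nat) :
  perm_eq s1 s2 -> sort leq s1 = sort leq s2.
Proof. by move/(perm_sortP leq_total leq_trans anti_leq). Qed.

Section Identities.
Variable K : fieldType.
Implicit Types (e : nat -> nat) (t : nat -> nat -> K) (w S b : seq nat).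
Implicit Types (l : seq (K * seq nat)) (p q k x : nat) (g : seq nat * nat).

Local Notation sortn := (sort leq).

Definition sort_head w p := sortn (take p w) ++ drop p w.

(** All that the p-th sorting step sees of a word: the ordered head and the
    letter to be inserted into it. *)
Definition head_key p w := (sortn (take p w), nth 0%N w p).

Definition key_letters g := rcons g.1 g.2.

(** The terms with key g at position p, stripped of that key. *)
Definition tails p g l :=
  [seq (c.1, drop p.+1 c.2) | c <- l & head_key p c.2 == g].

Lemma sort_headE p w : (p < size w)%N ->
  sort_head w p = key_letters (head_key p w) ++ drop p.+1 w.
Proof.
by move=> lt_p; rewrite /sort_head (drop_nth 0%N lt_p) /key_letters cat_rcons.
Qed.

Lemma perm_key_letters p w : (p < size w)%N ->
  perm_eq (key_letters (head_key p w)) (take p.+1 w).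
Proof.
move=> lt_p; rewrite (take_nth 0%N lt_p) /key_letters /=.
by rewrite -!cats1 perm_cat2r perm_sort.
Qed.

Lemma sort_headS p w : (p < size w)%N ->
  sort_head w p.+1 = sortn (key_letters (head_key p w)) ++ drop p.+1 w.
Proof.
move=> lt_p; congr (_ ++ _); apply: sort_leq_perm.
by rewrite perm_sym perm_key_letters.
Qed.

Lemma telescope_sort_head (V : zmodType) (F : seq nat -> V) w :
  F w - F (sortn w) =
  \sum_(p < size w) (F (sort_head w p) - F (sort_head w p.+1)).
Proof.
rewrite -(big_mkord xpredT (fun p => F (sort_head w p) - F (sort_head w p.+1))).
under eq_bigr => p _ do rewrite -opprB.
rewrite sumrN telescope_sumr // opprB; congr (F _ - F _).
  by rewrite /sort_head take0 drop0.
by rewrite /sort_head take_size drop_size cats0.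
Qed.

Lemma sum_by_key (V : nmodType) (I J : eqType) (r : seq I) (key : I -> J)
    (F : I -> V) :
  \sum_(i <- r) F i =
  \sum_(j <- undup (map key r)) \sum_(i <- r | key i == j) F i.
Proof.
rewrite [RHS](exchange_big_dep predT) //= big_seq [RHS]big_seq.
apply: eq_bigr => i ir.
rewrite [RHS]big_mkcond (bigD1_seq (key i)) ?undup_uniq ?mem_undup ?map_f //=.
by rewrite eqxx big1 ?addr0 // => j; rewrite eq_sym => /negbTE->.
Qed.

(** Sorting ever longer heads of the words turns each of them into the ordered
    word; the p-th step changes the head only, in a way that depends only on
    its key. *)
Lemma split_words (V : lmodType K) (F : seq nat -> V) S l : words_on S l ->
  \sum_(c <- l) c.1 *: F c.2 = (\sum_(c <- l) c.1) *: F (sortn S) +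
    \sum_(p < size S) \sum_(g <- undup (map (fun c => head_key p c.2) l))
      \sum_(c <- l | head_key p c.2 == g) c.1 *:
        (F (key_letters g ++ drop p.+1 c.2) -
         F (sortn (key_letters g) ++ drop p.+1 c.2)).
Proof.
move=> hl; apply/eqP; rewrite addrC -subr_eq scaler_suml -sumrB; apply/eqP.
have sortE c : c \in l -> sortn c.2 = sortn S.
  by move=> cl; apply/sort_leq_perm/hl.
transitivity (\sum_(c <- l) \sum_(p < size S)
    c.1 *: (F (sort_head c.2 p) - F (sort_head c.2 p.+1))).
  rewrite big_seq [RHS]big_seq; apply: eq_bigr => c cl.
  rewrite -scalerBr -(sortE _ cl) -(perm_size (hl _ cl)) telescope_sort_head.
  by rewrite scaler_sumr.
rewrite exchange_big /=; apply: eq_bigr => p _.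
rewrite (sum_by_key _ (fun c => head_key p c.2)); apply: eq_bigr => g _.
rewrite big_seq_cond [RHS]big_seq_cond; apply: eq_bigr => c /andP[cl /eqP <-].
by rewrite sort_headE ?sort_headS // (perm_size (hl _ cl)).
Qed.

Lemma word_sum_split S l : words_on S l ->
  word_sum l = (\sum_(c <- l) c.1) *: \prod_(s <- sortn S) fvar K s +
    \sum_(p < size S) \sum_(g <- undup (map (fun c => head_key p c.2) l))
      (\prod_(s <- key_letters g) fvar K s -
       \prod_(s <- sortn (key_letters g)) fvar K s) * word_sum (tails p g l).
Proof.
move=> /(split_words (fun w => \prod_(s <- w) fvar K s)).
rewrite /word_sum => ->.
congr (_ + _); apply: eq_bigr => p _; apply: eq_bigr => g _.
rewrite mulr_sumr big_map big_filter; apply: eq_bigr => c _ /=.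
by rewrite !big_cat /= -mulrBl freealg_scalerAr.
Qed.

Lemma value_split e t S l : words_on S l ->
  value e t 0 l = (\sum_(c <- l) c.1) * weight e t 0 (sortn S) +
    \sum_(p < size S) \sum_(g <- undup (map (fun c => head_key p c.2) l))
      (weight e t 0 (key_letters g) - weight e t 0 (sortn (key_letters g))) *
      value e t (\sum_(s <- key_letters g) e s) (tails p g l).
Proof.
move=> /(split_words (weight e t 0 : _ -> K^o)); rewrite /value => ->.
congr (_ + _); apply: eq_bigr => p _; apply: eq_bigr => g _.
rewrite mulr_sumr big_map big_filter; apply: eq_bigr => c _ /=.
rewrite !weight_cat !add0n.
rewrite [X in _ - _ * weight _ _ X _](perm_big (key_letters g)).
  by rewrite -mulrBl -mulrCA.
by rewrite perm_sort.
Qed.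

End Identities.

Section IdentityTheorem.
Variable K : fieldType.
Implicit Types (e : nat -> nat) (t : nat -> nat -> K) (w S b : seq nat).
Implicit Types (l : seq (K * seq nat)) (p q k x : nat) (g : seq nat * nat).

Local Notation sortn := (sort leq).

Definition rest g S := [seq s <- S | s \notin key_letters g].

Lemma words_on_tails S l p g : uniq S -> (p < size S)%N ->
  words_on S l -> words_on (rest g S) (tails p g l).
Proof.
move=> uS lt_p hl c' /mapP[c]; rewrite mem_filter => /andP[/eqP <- cl] -> /=.
have pS := hl c cl; rewrite -(perm_size pS) in lt_p.
have uc : uniq c.2 by rewrite (perm_uniq pS).
apply: uniq_perm; rewrite ?drop_uniq ?filter_uniq // => s.
rewrite mem_filter -(perm_mem pS) (perm_mem (perm_key_letters lt_p)).
move: uc; rewrite -[in uniq _](cat_take_drop p.+1 c.2) cat_uniq.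
case/and3P=> _ /hasPn disj _.
rewrite -[X in _ && (s \in X)](cat_take_drop p.+1 c.2) mem_cat.
case sd: (s \in drop _ _); last by case: (s \in take _ _).
by rewrite orbT andbT; apply/esym/disj.
Qed.

Lemma sum_rest g S (F : nat -> nat) :
    uniq S -> uniq (key_letters g) -> {subset key_letters g <= S} ->
  (\sum_(s <- S) F s =
   \sum_(s <- key_letters g) F s + \sum_(s <- rest g S) F s)%N.
Proof.
move=> uS ug sub; rewrite (bigID (mem (key_letters g))) /= big_filter.
congr (_ + _)%N; rewrite -big_filter; apply: perm_big.
apply: uniq_perm; rewrite ?filter_uniq // => s; rewrite mem_filter.
by case sg: (s \in key_letters g); rewrite //= (sub _ sg).
Qed.

Lemma weight_sortn_diag e t w : {in w, forall s, e s = 0%N} ->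
  weight e t 0 (sortn w) = weight e t 0 w.
Proof.
move=> h; rewrite !weight_diag //; first by apply: perm_big; rewrite perm_sort.
by move=> s; rewrite mem_sort; apply: h.
Qed.

(** Sorting an unsorted list b, x with b sorted brings a letter of b to the
    end. *)
Lemma sortn_unsorted_rcons b x : sorted leq b -> ~~ sorted leq (rcons b x) ->
  exists u y, [/\ sortn (rcons b x) = rcons u y, y \in b & x \in u].
Proof.
move=> sb nsbx.
have : perm_eq (sortn (rcons b x)) (rcons b x) by rewrite perm_sort.
have : sorted leq (sortn (rcons b x)) by apply: sort_sorted; apply: leq_total.
case/lastP: (sortn _) => [_ /perm_size|u y su pu]; first by rewrite size_rcons.
exists u, y; suff neq_yx : y != x.
  split=> //.
    have : y \in rcons b x by rewrite -(perm_mem pu) mem_rcons mem_head.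
    by rewrite mem_rcons inE (negbTE neq_yx).
  have : x \in rcons u y by rewrite (perm_mem pu) mem_rcons mem_head.
  by rewrite mem_rcons inE eq_sym (negbTE neq_yx).
apply/negP => /eqP eyx; case/negP: nsbx; move: su pu.
rewrite eyx -!cats1 perm_cat2r => su pub; suff -> : b = u by [].
apply: (sorted_eq leq_trans anti_leq) => //; last by rewrite perm_sym.
by case/cat_sorted2: su.
Qed.

Section Probe.
Variables (e : nat -> nat) (t : nat -> nat -> K) (b : seq nat) (x : nat).

(** The substitution that detects the key (b, x): the letters of b live in
    row 0, x leads from row 0 to row 1, and all others live in rows 1, 2, ...,
    where they act as prescribed by e and t on rows 0, 1, ... *)
Definition probe_step s : nat :=
  if s \in b then 0%N else if s == x then 1%N else e s.
Definition probe_coef s i : K :=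
  if s \in rcons b x then (i == 0%N)%:R else if i is j.+1 then t s j else 0.

Hypotheses (sb : sorted leq b) (nsbx : ~~ sorted leq (rcons b x)).
Hypothesis (ubx : uniq (rcons b x)).

Let xNb : x \notin b.
Proof. by move: ubx; rewrite rcons_uniq => /andP[]. Qed.

Let probe_step_b s : s \in b -> probe_step s = 0%N.
Proof. by rewrite /probe_step => ->. Qed.

Let probe_step_x : probe_step x = 1%N.
Proof. by rewrite /probe_step (negbTE xNb) eqxx. Qed.

Lemma probe_weight_rcons u y : y \in b -> x \in u ->
  weight probe_step probe_coef 0 (rcons u y) = 0.
Proof.
move=> yb xu; rewrite weight_rcons add0n /probe_coef mem_rcons inE yb orbT.
by rewrite (big_rem x) //= probe_step_x add1n mulr0.
Qed.

Lemma probe_weight_tail w i y : y \in rcons b x -> y \in w ->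
  weight probe_step probe_coef i.+1 w = 0.
Proof.
by move=> ybx /weight_eq0; apply=> -[|j] // _; rewrite /probe_coef ybx.
Qed.

Lemma probe_weight_rest w : {in w, forall s, s \notin rcons b x} ->
  weight probe_step probe_coef 1 w = weight e t 0 w.
Proof.
move=> h; rewrite -[1%N]addn0; apply: weight_shift => s /h nsbx'.
move: (nsbx'); rewrite mem_rcons inE negb_or => /andP[/negbTE nx /negbTE nb].
rewrite /probe_step nb nx; split=> // j _.
by rewrite /probe_coef (negbTE nsbx').
Qed.

Lemma probe_weight_key :
  weight probe_step probe_coef 0 (rcons b x) -
  weight probe_step probe_coef 0 (sortn (rcons b x)) = 1.
Proof.
have [u [y [-> yb xu]]] := sortn_unsorted_rcons sb nsbx.
rewrite (probe_weight_rcons yb xu) subr0 weight_rcons.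
rewrite weight_diag => [|s sb']; last by rewrite probe_step_b.
rewrite big1_seq => [|s /= sb']; last first.
  by rewrite /probe_coef mem_rcons inE sb' orbT.
rewrite big1_seq => [|s /= sb']; last by rewrite probe_step_b.
by rewrite mul1r /probe_coef mem_rcons mem_head.
Qed.

(** Another key with the same letters ends in a letter of b, so neither its
    word nor the sorted one can end in row 1. *)
Lemma probe_weight_other_key b' x' :
  sorted leq b' -> perm_eq (rcons b' x') (rcons b x) -> (b', x') != (b, x) ->
  weight probe_step probe_coef 0 (rcons b' x') -
  weight probe_step probe_coef 0 (sortn (rcons b' x')) = 0.
Proof.
move=> sb' pbx neq; have -> : sortn (rcons b' x') = sortn (rcons b x).
  exact: sort_leq_perm.
have [u [y [-> yb xu]]] := sortn_unsorted_rcons sb nsbx.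
rewrite (probe_weight_rcons yb xu) subr0.
have neq_x : x' != x.
  apply: contra neq => /eqP ex; move: pbx; rewrite ex -!cats1 perm_cat2r => pb.
  by rewrite (sorted_eq leq_trans anti_leq sb' sb pb).
apply: probe_weight_rcons.
  have : x' \in rcons b x by rewrite -(perm_mem pbx) mem_rcons mem_head.
  by rewrite mem_rcons inE (negbTE neq_x).
have : x \in rcons b' x' by rewrite (perm_mem pbx) mem_rcons mem_head.
by rewrite mem_rcons inE eq_sym (negbTE neq_x).
Qed.

Lemma probe_step_key : (\sum_(s <- rcons b x) probe_step s = 1)%N.
Proof.
rewrite -cats1 big_cat big_seq1 big1_seq => [|s /= /probe_step_b //].
by rewrite probe_step_x.
Qed.

Lemma probe_step_sum S : uniq S -> {subset rcons b x <= S} ->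
  (\sum_(s <- S) probe_step s = 1 + \sum_(s <- rest (b, x) S) e s)%N.
Proof.
move=> uS sub; rewrite (sum_rest (g := (b, x))) // probe_step_key.
congr (_ + _)%N.
rewrite !big_filter; apply: eq_bigr => s; rewrite mem_rcons inE negb_or.
by case/andP=> /negbTE nx /negbTE nb; rewrite /probe_step nb nx.
Qed.

End Probe.

End IdentityTheorem.

Section LowVanish.
Variable K : fieldType.
Implicit Types (e : nat -> nat) (t : nat -> nat -> K) (w S b : seq nat).
Implicit Types (l : seq (K * seq nat)) (p q k x : nat) (g : seq nat * nat).

Local Notation sortn := (sort leq).

Lemma low_vanish_coef k S l : low_vanish k.+1 S l -> \sum_(c <- l) c.1 = 0.
Proof.
move=> lv; rewrite -[RHS](lv (fun=> 0%N) (fun _ _ => 1)); last by rewrite big1.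
by apply: eq_bigr => c _; rewrite weight_diag // big1 ?mulr1.
Qed.

Lemma head_key_letters S l p g : uniq S -> words_on S l -> (p < size S)%N ->
    g \in undup (map (fun c => head_key p c.2) l) ->
  [/\ sorted leq g.1, uniq (key_letters g), size (key_letters g) = p.+1
    & {subset key_letters g <= S}].
Proof.
move=> uS hl lt_p; rewrite mem_undup => /mapP[c cl ->].
have pS := hl c cl; rewrite -(perm_size pS) in lt_p.
have pg := perm_key_letters lt_p; split.
- by apply: sort_sorted; apply: leq_total.
- by rewrite (perm_uniq pg) take_uniq // (perm_uniq pS).
- by rewrite (perm_size pg) size_takel.
by move=> s; rewrite (perm_mem pg) => /mem_take; rewrite (perm_mem pS).
Qed.

(** By descending induction on the position p. Under the probe of (b, x), built
    on a substitution of fewer than k steps for the other letters, the whole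
    polynomial vanishes, since x adds a single step. Consider the term of a key
    h in the telescope. If no letter of h makes a step, then sorting h does not
    change its weight, and the term is 0. Otherwise the tails of h are read
    from a row past 0, so the term is 0 unless h comprises all letters of b, x.
    In that case either h is at a later position, and its tails vanish because
    fewer than k steps are left for them, or h has the same letters as b, x,
    and only h = (b, x) survives, with coefficient 1. What remains is the value
    of the tails of (b, x). *)
Lemma tails_low_vanish k S l p g :
    uniq S -> words_on S l -> low_vanish k.+1 S l ->
    (p < size S)%N -> ~~ sorted leq (key_letters g) ->
  low_vanish k (rest g S) (tails p g l).
Proof.
move=> uS hl lv; move: {2}(size S - p)%N (leqnn (size S - p)) => N.
elim: N p g => [|N IHN] p [b x] le_N lt_p nsbx.
  by move: le_N; rewrite leqn0 subn_eq0 leqNgt lt_p.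
move=> e t lt_k; have [gl|gNl] := boolP
  ((b, x) \in undup (map (fun c => head_key p c.2) l)); last first.
  rewrite /value /tails (_ : filter _ _ = [::]) ?big_nil //.
  apply/eqP; rewrite -[_ == _]negbK -has_filter; apply: contra gNl.
  move=> /hasP[c cl /eqP <-].
  by rewrite mem_undup (map_f (fun c => head_key p c.2)).
have [sb ubx szb sub] := head_key_letters uS hl lt_p gl.
pose e' := probe_step e b x; pose t' := probe_coef t b x.
have sum_e' := probe_step_sum e ubx uS sub.
have others q h : (q < size S)%N -> (q, h) != (p, (b, x)) ->
    h \in undup (map (fun c => head_key q c.2) l) ->
  (weight e' t' 0 (key_letters h) - weight e' t' 0 (sortn (key_letters h))) *
    value e' t' (\sum_(s <- key_letters h) e' s) (tails q h l) = 0.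
  move=> lt_q neq hl'; have [sh uh szh subh] := head_key_letters uS hl lt_q hl'.
  have [E0|E_gt0] := posnP (\sum_(s <- key_letters h) e' s).
    rewrite weight_sortn_diag ?subrr ?mul0r // => s sh'; apply/eqP.
    move/eqP: E0; rewrite sum_nat_seq_eq0 => /allP/(_ s sh').
    by [].
  (* A letter y of b, x that is missing from the key h is read in the tails,
     in a row past 0. *)
  have [/allP sub_h|/allPn[y ybx yNh]] :=
    boolP (all (mem (key_letters h)) (rcons b x)); last first.
    rewrite /value big1_seq ?mulr0 // => c /= cl.
    have pc := words_on_tails uS lt_q hl cl.
    rewrite -(prednK E_gt0) (probe_weight_tail _ _ _ ybx) ?mulr0 //.
    by rewrite (perm_mem pc) mem_filter yNh sub.
  have := uniq_leq_size ubx sub_h; rewrite szb szh ltnS leq_eqVlt.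
  case/orP=> [/eqP epq|lt_pq].
    rewrite -epq in szh neq.
    case: h sh uh szh neq sub_h {hl' subh E_gt0} => b' x'.
    move=> sb' ubx' szb' neq sub_h.
    rewrite probe_weight_other_key ?mul0r //; last first.
      by apply: contra neq => /eqP->.
    apply: uniq_perm => // s; symmetry.
    by have [] := uniq_min_size ubx sub_h _; rewrite ?szb ?szb'.
  have [sorted_h|nsh] := boolP (sorted leq (key_letters h)).
    by rewrite (sorted_sort leq_trans sorted_h) subrr mul0r.
  rewrite (low_vanish_row _ _ (IHN q h _ lt_q nsh)) ?mulr0 //.
    by rewrite -ltnS; apply: leq_trans le_N; apply: ltn_sub2l.
  have := sum_rest e' uS uh subh; rewrite sum_e' => sum_h.
  apply: leq_ltn_trans lt_k; rewrite -(leq_add2l 1) sum_h leq_add2r.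
  exact: E_gt0.
have := lv e' t'; rewrite sum_e' add1n ltnS => /(_ lt_k).
rewrite (value_split _ _ hl) (low_vanish_coef lv) mul0r add0r.
rewrite (bigD1 (Ordinal lt_p)) //=.
rewrite [X in _ + X]big1 ?addr0 => [|q neq]; last first.
  apply: big1_seq => h /= hh; apply: others => //.
  by apply: contra neq => /eqP[/eqP].
rewrite (bigD1_seq (b, x)) ?undup_uniq //= [X in _ + X]big_seq_cond.
rewrite [X in _ + X]big1 ?addr0 => [|h /andP[hh neq]]; last first.
  by apply: others => //; apply: contra neq => /eqP[->].
rewrite probe_weight_key // mul1r => <-; apply: eq_big_seq => c cl.
have pc := words_on_tails uS lt_p hl cl; congr (_ * _).
rewrite probe_step_key // probe_weight_rest // => s.
by rewrite (perm_mem pc) mem_filter => /andP[].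
Qed.

(** Each step of the telescope is a product of two factors: the difference of a
    head and its sorted form, which lies in the commutator ideal, and the tails
    of a key, which lie in its (k-1)-st power by induction on k. The fully
    ordered word has coefficient 0, by the substitution of 1 for all
    letters. *)
Theorem low_vanish_comm_power k S l :
  uniq S -> words_on S l -> low_vanish k S l -> comm_power k (word_sum l).
Proof.
elim: k S l => [|k IHk] S l uS hl lv; first exact: Comm_power_all.
rewrite (word_sum_split hl) (low_vanish_coef lv) scale0r add0r.
apply: comm_power_sum => p _; apply: comm_power_sum => g _.
have [sorted_g|nsg] := boolP (sorted leq (key_letters g)).
  by rewrite (sorted_sort leq_trans) // subrr mul0r; apply: Comm_power_zero.
apply: comm_power1_mul.
  by apply: comm_power1_perm; rewrite perm_sym perm_sort.
apply: (IHk (rest g S)); first exact: filter_uniq.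
  exact: words_on_tails.
exact: tails_low_vanish.
Qed.

End LowVanish.

(** * Generic substitutions *)

Section Generic.
Variable K : fieldType.
Implicit Types (t T U : nat -> nat -> K) (F G : (nat -> nat -> K) -> K).

(** Over an infinite field, functions that are polynomial along every line
    behave like polynomials as far as simultaneous nonvanishing goes. *)
Definition line_poly F := forall T T', exists p : {poly K},
  forall x U, (forall s i, U s i = T s i + x * T' s i) -> F U = p.[x].

Lemma line_poly_const c : line_poly (fun=> c).
Proof. by move=> T T'; exists c%:P => x U _; rewrite hornerC. Qed.

Lemma line_poly_coord s i : line_poly (fun T => T s i).
Proof.
move=> T T'; exists ((T s i)%:P + T' s i *: 'X) => x U ->.
by rewrite hornerD hornerC hornerZ hornerX mulrC.
Qed.

Lemma line_polyD F G :
  line_poly F -> line_poly G -> line_poly (fun T => F T + G T).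
Proof.
move=> hF hG T T'; have [p hp] := hF T T'; have [q hq] := hG T T'.
by exists (p + q) => x U hU; rewrite hornerD (hp x) ?(hq x).
Qed.

Lemma line_polyM F G :
  line_poly F -> line_poly G -> line_poly (fun T => F T * G T).
Proof.
move=> hF hG T T'; have [p hp] := hF T T'; have [q hq] := hG T T'.
by exists (p * q) => x U hU; rewrite hornerM (hp x) ?(hq x).
Qed.

Lemma line_poly_sum (I : Type) (r : seq I) (H : I -> (nat -> nat -> K) -> K) :
  (forall i, line_poly (H i)) -> line_poly (fun T => \sum_(i <- r) H i T).
Proof.
move=> hH; elim: r => [|i r IHr] T T'.
  by exists 0 => x U _; rewrite big_nil horner0.
have [p hp] := line_polyD (hH i) IHr T T'.
by exists p => x U hU; rewrite big_cons (hp x).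
Qed.

Hypothesis K_infinite : infinite_field K.

Lemma infinite_field_uniq n : exists s : seq K, uniq s /\ size s = n.
Proof.
elim: n => [|n [s [us sz_s]]]; first by exists [::].
by have [x xNs] := K_infinite s; exists (x :: s); rewrite /= xNs us sz_s.
Qed.

Lemma poly_nonroot (p : {poly K}) : p != 0 -> exists x, p.[x] != 0.
Proof.
move=> p0; have [s [us sz_s]] := infinite_field_uniq (size p).
have [|/allPn[x _ ?]] := boolP (all (root p) s); last by exists x.
by move=> /(max_poly_roots p0)/(_ us); rewrite sz_s ltnn.
Qed.

(** Along the line that joins a point where F does not vanish to one where G
    does not vanish, F and G restrict to nonzero polynomials. *)
Lemma line_poly_nonzeroM F G : line_poly F -> line_poly G ->
    (exists T, F T != 0) -> (exists T, G T != 0) ->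
  exists T, F T * G T != 0.
Proof.
move=> hF hG [T0 FT0] [T1 GT1]; pose D s i := T1 s i - T0 s i.
have [p hp] := hF T0 D; have [q hq] := hG T0 D.
have p0 : p != 0.
  apply: contraNneq FT0 => p0; rewrite (hp 0) ?p0 ?horner0 // => s i.
  by rewrite mul0r addr0.
have q0 : q != 0.
  apply: contraNneq GT1 => q0; rewrite (hq 1) ?q0 ?horner0 // => s i.
  by rewrite mul1r addrC subrK.
have [x] := poly_nonroot (mulf_neq0 p0 q0); rewrite hornerM => pq0.
by exists (fun s i => T0 s i + x * D s i); rewrite (hp x) // (hq x).
Qed.

Lemma line_poly_common (I : eqType) (r : seq I)
    (H : I -> (nat -> nat -> K) -> K) :
    (forall i, line_poly (H i)) ->
    (forall i, i \in r -> exists T, H i T != 0) ->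
  exists T, forall i, i \in r -> H i T != 0.
Proof.
move=> hH nzH; suff [T nzT] : exists T, \prod_(i <- r) H i T != 0.
  exists T => i ir; apply: contraNneq nzT => HT0.
  by rewrite (big_rem i) //= HT0 mul0r.
have lin_prod s : line_poly (fun T => \prod_(i <- s) H i T).
  elim: s => [|i s IHs] T T'.
    by exists 1 => x U _; rewrite big_nil hornerC.
  have [p hp] := line_polyM (hH i) IHs T T'.
  by exists p => x U hU; rewrite big_cons (hp x).
elim: r nzH => [|i r IHr] nzH.
  by exists (fun _ _ => 0); rewrite big_nil oner_neq0.
have [] := line_poly_nonzeroM (hH i) (lin_prod r) (nzH i (mem_head _ _)).
  by apply: IHr => j jr; apply: nzH; rewrite inE jr orbT.
by move=> T nzT; exists T; rewrite big_cons.
Qed.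

End Generic.

(** * The first step of a word *)

Section FirstStep.
Variable K : fieldType.
Implicit Types (e : nat -> nat) (t T : nat -> nat -> K) (w S : seq nat).
Implicit Types (l : seq (K * seq nat)) (a d s z : nat).

(** Row 0 can be left only through the letter z. *)
Definition first_coef e t z s i : K :=
  if (i == 0%N) && (0 < e s)%N then (s == z)%:R else t s i.

(** Exactly one letter of a word makes the first proper step, from row 0, and
    the summand of any other letter vanishes. *)
Lemma weight_first e t w : uniq w -> has (fun s => 0 < e s)%N w ->
  weight e t 0 w =
  \sum_(z <- w | (0 < e z)%N) t z 0%N * weight e (first_coef e t z) 0 w.
Proof.
elim: w => //= y w IHw /andP[yNw uw] hw; rewrite big_cons add0n.
have [ey0|ey_gt0] := posnP (e y).
  rewrite ey0 /= in hw *; rewrite IHw // mulr_sumr; apply: eq_bigr => z _.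
  by rewrite /first_coef ey0 /= mulrCA.
rewrite [X in _ + X]big1_seq ?addr0 => [|z /andP[_ zw]]; last first.
  rewrite {1}/first_coef ey_gt0 /= (_ : (y == z) = false) ?mul0r ?mulr0 //.
  by apply: contraNF yNw => /eqP->.
rewrite {1}/first_coef ey_gt0 !eqxx mul1r; congr (_ * _).
rewrite -[e y]add0n; symmetry; apply: weight_shift => s _.
split=> // j le_j; rewrite add0n /first_coef.
by rewrite eqn0Ngt (leq_trans ey_gt0 le_j).
Qed.

Lemma value_first e t S l : uniq S -> words_on S l ->
    (0 < \sum_(s <- S) e s)%N -> value e t 0 l != 0 ->
  exists z, [/\ z \in S, (0 < e z)%N & value e (first_coef e t z) 0 l != 0].
Proof.
move=> uS hl e_gt0 nz; have hS : has (fun s => 0 < e s)%N S.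
  apply: contraTT e_gt0 => /hasPn h; rewrite -eqn0Ngt sum_nat_seq_eq0.
  by apply/allP => s /h; rewrite -eqn0Ngt.
pose nzP z := (0 < e z)%N && (value e (first_coef e t z) 0 l != 0).
have [/hasP[z zS /andP[]]|/hasPn noz] := boolP (has nzP S); first by exists z.
case/eqP: nz; rewrite /value big_seq.
under eq_bigr => c cl.
  rewrite weight_first ?(perm_uniq (hl c cl)) ?(perm_has _ (hl c cl)) //.
  rewrite (perm_big _ (hl c cl)) /= mulr_sumr.
  over.
rewrite -big_seq exchange_big /= big1_seq // => z /andP[ez zS].
under eq_bigr do rewrite mulrCA.
have := noz z zS; rewrite /nzP ez negbK => /eqP v0.
by rewrite -mulr_sumr [X in _ * X]v0 mulr0.
Qed.

Section Jump.
Variables (e : nat -> nat) (z : nat).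

(** The letter z leaves row a, and only row a, with D steps more than e z. *)
Definition jump_step (D s : nat) : nat := if s == z then (D + e z)%N else e s.
Definition jump_coef T a s i : K := if s == z then (i == a)%:R else T s i.

Lemma line_poly_value D a i l :
  line_poly (fun T => value (jump_step D) (jump_coef T a) i l).
Proof.
apply: line_poly_sum => c; apply: line_polyM; first exact: line_poly_const.
case: c => _ w /=; elim: w i => [|s w IHw] i /=; first exact: line_poly_const.
apply: line_polyM => //; rewrite /jump_coef.
case: (s == z); [exact: line_poly_const | exact: line_poly_coord].
Qed.

Lemma sum_jump_step D S : uniq S -> z \in S ->
  (\sum_(s <- S) jump_step D s = D + \sum_(s <- S) e s)%N.
Proof.
move=> uS zS; rewrite (bigD1_seq z) // [in RHS](bigD1_seq z) //= addnA.
rewrite /jump_step eqxx; congr (_ + _)%N.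
by apply: eq_bigr => s /negbTE->.
Qed.

(** Rows only increase, so a word that starts below row a never meets it, and
    the letter z kills the word. *)
Lemma value_jump0 D T a i S l : z \in S -> words_on S l -> (a < i)%N ->
  value (jump_step D) (jump_coef T a) i l = 0.
Proof.
move=> zS hl lt_ai; rewrite /value big1_seq // => c /= cl.
rewrite (@weight_eq0 _ _ _ _ _ z) ?mulr0 ?(perm_mem (hl c cl)) // => j le_j.
by rewrite /jump_coef eqxx gtn_eqF // (leq_trans lt_ai).
Qed.

(** Relabelling row 0 as a, and row i as a + D + i for positive i, turns the
    substitution of first_coef into one where z jumps from row a. *)
Lemma value_jump t D a S l : uniq S -> z \in S -> (0 < e z)%N -> words_on S l ->
  exists T, value (jump_step D) (jump_coef T a) a l =
            value e (first_coef e t z) 0 l.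
Proof.
move=> uS zS ez hl; pose tz := first_coef e t z.
pose T s j := if j == a then tz s 0%N else tz s (j - (a + D))%N.
exists T; apply: eq_big_seq => c cl; congr (_ * _).
have zc : z \in c.2 by rewrite (perm_mem (hl c cl)).
have : uniq c.2 by rewrite (perm_uniq (hl c cl)).
elim: c.2 zc => //= y w IHw; rewrite inE => /orP[/eqP <-|zw] /andP[zNw uw].
  rewrite /jump_coef /jump_step !eqxx mul1r {1}/first_coef ez !eqxx mul1r.
  rewrite add0n addnA; apply: weight_shift => s sw.
  have /negbTE nsz : s != z by apply: contraNneq zNw => <-.
  rewrite nsz; split=> // j le_j.
  rewrite /T addKn ifN // -addnA -[X in _ != X]addn0 eqn_add2l -lt0n addn_gt0.
  by rewrite (leq_trans ez le_j) orbT.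
have /negbTE nyz : y != z by apply: contraNneq zNw => ->.
have -> : jump_step D y = e y by rewrite /jump_step nyz.
have -> : jump_coef T a y a = tz y 0%N by rewrite /jump_coef nyz /T eqxx.
have [ey0|ey_gt0] := posnP (e y); first by rewrite ey0 !addn0 IHw.
have tz0 : tz y 0%N = 0 by rewrite /tz /first_coef ey_gt0 nyz.
by rewrite -/tz tz0 !mul0r.
Qed.

End Jump.

End FirstStep.

(** * Surjectivity onto a power of the radical *)

Section Multilinearity.
Variables (K : fieldType) (A : algType K).

Definition set_letter (z : nat) (B : A) (a : nat -> A) (s : nat) : A :=
  if s == z then B else a s.

Lemma prod_set_letter z B a u v : uniq (u ++ z :: v) ->
  \prod_(s <- u ++ z :: v) set_letter z B a s =
  \prod_(s <- u) a s * B * \prod_(s <- v) a s.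
Proof.
rewrite cat_uniq /= negb_or => /and3P[_ /andP[zNu _] /andP[zNv _]].
have other w : z \notin w ->
    \prod_(s <- w) set_letter z B a s = \prod_(s <- w) a s.
  move=> zNw; apply: eq_big_seq => s sw; rewrite /set_letter ifN //.
  by apply: contraNneq zNw => <-.
by rewrite big_cat big_cons !other //= /set_letter eqxx mulrA.
Qed.

Lemma feval_set_letter (S : seq nat) (l : seq (K * seq nat)) z a
    (I : Type) (r : seq I) (P : pred I) (c : I -> K) (B : I -> A) :
    uniq S -> words_on S l -> z \in S ->
  feval (set_letter z (\sum_(k <- r | P k) c k *: B k) a) (word_sum l) =
  \sum_(k <- r | P k) c k *: feval (set_letter z (B k) a) (word_sum l).
Proof.
move=> uS hl zS; rewrite feval_word_sum.
under [RHS]eq_bigr => k _ do rewrite feval_word_sum scaler_sumr.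
rewrite exchange_big /=; apply: eq_big_seq => -[x w] /= cl.
have zw : z \in w by rewrite (perm_mem (hl _ cl)).
have uw : uniq w by rewrite (perm_uniq (hl _ cl)).
case/splitPr: zw uw {cl} => u v uw.
rewrite prod_set_letter // mulr_sumr mulr_suml scaler_sumr.
apply: eq_bigr => k _.
by rewrite prod_set_letter // -scalerAr -scalerAl !scalerA mulrC.
Qed.

End Multilinearity.

Section Surjectivity.
Variables (K : fieldType) (n : nat) (S : seq nat) (l : seq (K * seq nat)).
Variables (e : nat -> nat) (T : nat -> nat -> K) (z : nat).
Implicit Types M : 'M[K]_n.+1.

Let d := (\sum_(s <- S) e s)%N.

Hypotheses (uS : uniq S) (hl : words_on S l) (zS : z \in S).

(** What row a receives when z is sent to a matrix unit of row i, with the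
    column chosen so that the d - e z steps of the other letters complete the
    way from i to j. *)
Let jump_value (i j a : nat) : K :=
  value (jump_step e z (j - (i + d))) (jump_coef z T i) a l.

Hypothesis jump_value_neq0 :
  forall i j : 'I_n.+1, (i + d <= j)%N -> jump_value i j i != 0.

Let jump_mx (i j : nat) : 'M[K]_n.+1 :=
  step_mx n (jump_step e z (j - (i + d))) (jump_coef z T i) z.

Let image_mx (i j : 'I_n.+1) : 'M[K]_n.+1 :=
  feval (set_letter z (jump_mx i j) (step_mx n e T)) (word_sum l).

Let image_mxE (i j a b : 'I_n.+1) : (i + d <= j)%N ->
  image_mx i j a b = jump_value i j a *+ (b == (a + (j - i))%N :> nat).
Proof.
move=> le_ij; pose D := (j - (i + d))%N.
have -> : image_mx i j =
    feval (step_mx n (jump_step e z D) (jump_coef z T i)) (word_sum l).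
  rewrite /image_mx !feval_word_sum; apply: eq_bigr => c _; congr (_ *: _).
  apply: eq_bigr => s _; rewrite /set_letter; case: eqP => [-> //|/eqP ne].
  by apply/matrixP => r q; rewrite !mxE /jump_step /jump_coef (negbTE ne).
rewrite (feval_step_mx _ _ _ _ hl) sum_jump_step // /D -/d.
suff -> : (j - (i + d) + d = j - i)%N by [].
by rewrite subnDA subnK // leq_subRL // (leq_trans _ le_ij) ?leq_addr.
Qed.

(** The value of the polynomial as a linear function of the matrix put for z,
    with the columns shifted so that it maps the d-th power of the radical to
    itself. *)
Let L M : 'M[K]_n.+1 :=
  \sum_(ij : 'I_n.+1 * 'I_n.+1 | (ij.1 + d <= ij.2)%N)
    M ij.1 ij.2 *: image_mx ij.1 ij.2.

Fact L_is_linear : linear L.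
Proof.
move=> c M N; rewrite /L scaler_sumr -big_split; apply: eq_bigr => ij _ /=.
by rewrite !mxE scalerDl scalerA.
Qed.

#[local] HB.instance Definition _ :=
  GRing.isLinear.Build K 'M[K]_n.+1 'M[K]_n.+1 *:%R L L_is_linear.

Let LE M (a b : 'I_n.+1) : L M a b =
  \sum_(ij : 'I_n.+1 * 'I_n.+1 | (ij.1 + d <= ij.2)%N)
    M ij.1 ij.2 *
    (jump_value ij.1 ij.2 a *+ (b == (a + (ij.2 - ij.1))%N :> nat)).
Proof.
by rewrite summxE; apply: eq_bigr => -[i j] le_ij; rewrite mxE image_mxE.
Qed.

Let L_unit_span M : L M \in unit_span K n d.
Proof.
apply/mem_unit_span => a b lt_b; rewrite LE big1 // => -[i j] /= le_ij.
rewrite (_ : (b == _ :> nat) = false) ?mulr0 // ltn_eqF //.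
apply: leq_trans lt_b _; rewrite leq_add2l leq_subRL //.
exact: leq_trans (leq_addr _ _) le_ij.
Qed.

(** In the last nonzero row a of M, the entry (a, b) of L M comes from the
    entry (a, b) of M alone: a word whose jumping letter leaves row i kills the
    rows below row i, and the earlier rows only feed the rows above. *)
Let L_inj M : M \in unit_span K n d -> L M = 0 -> M = 0.
Proof.
move=> /mem_unit_span hM LM0; apply/eqP; apply: contraT => M0.
have [[a b] /= Mab] : exists ab : 'I_n.+1 * 'I_n.+1, M ab.1 ab.2 != 0.
  apply/existsP; apply: contraNT M0 => /existsPn h; apply/eqP/matrixP => i j.
  by rewrite mxE; apply/eqP; have := h (i, j); rewrite negbK.
case: (@arg_maxnP _ (a, b) (fun ab => M ab.1 ab.2 != 0) (fun ab => ab.1) Mab).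
move=> {Mab} {}[{}a {}b] /= Mab max_a.
have le_ab : (a + d <= b)%N.
  by rewrite leqNgt; apply: contra Mab => /hM->.
move/matrixP/(_ a b): LM0; rewrite LE mxE (bigD1 (a, b)) //= big1 ?addr0.
  rewrite subnKC ?(leq_trans (leq_addr _ _) le_ab) // eqxx mulr1n => /eqP.
  by rewrite mulf_eq0 (negbTE Mab) (negbTE (jump_value_neq0 le_ab)).
case=> i j /= /andP[le_ij ne]; have [-> |Mij] := eqVneq (M i j) 0.
  by rewrite mul0r.
have := max_a (i, j) Mij; rewrite /= leq_eqVlt => /orP[/eqP ei|lt_ia].
  rewrite (_ : (b == _ :> nat) = false) ?mulr0 //; apply: contraNF ne.
  have {}ei : i = a by apply: val_inj.
  rewrite ei in le_ij *; rewrite subnKC ?(leq_trans (leq_addr _ _) le_ij) //.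
  by move=> /eqP ej; rewrite xpair_eqE eqxx /= -val_eqE /= ej.
by rewrite /jump_value (value_jump0 _ _ _ zS hl lt_ia) mul0rn mulr0.
Qed.

Let L_surj M : M \in unit_span K n d -> exists M', L M' = M.
Proof.
move=> hM; pose f : 'End('M[K]_n.+1) := linfun L.
have fE N : f N = L N by rewrite lfunE.
have cap0 : (unit_span K n d :&: lker f = 0)%VS.
  apply/eqP; rewrite -subv0; apply/subvP => N; rewrite memv_cap memv_ker fE.
  by case/andP=> hN /eqP /(L_inj hN) ->; rewrite mem0v.
have sub : (f @: unit_span K n d <= unit_span K n d)%VS.
  by apply/subvP => _ /memv_imgP[N _ ->]; rewrite fE L_unit_span.
have : (f @: unit_span K n d)%VS = unit_span K n d.
  by apply/eqP; rewrite eqEdim sub (limg_dim_eq cap0) leqnn.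
move=> Ef; move: hM; rewrite -{1}Ef => /memv_imgP[N _ ->].
by exists N; rewrite fE.
Qed.

Lemma jump_image M : M \in unit_span K n d -> UT_image (word_sum l) M.
Proof.
move=> /L_surj[M' <-].
exists (set_letter z (\sum_(ij : 'I_n.+1 * 'I_n.+1 | (ij.1 + d <= ij.2)%N)
  M' ij.1 ij.2 *: jump_mx ij.1 ij.2) (step_mx n e T)); split.
  move=> s; rewrite /set_letter; case: (s == z); last exact: step_mx_UT.
  by apply: memv_suml => ij _; rewrite memvZ // step_mx_UT.
by rewrite (feval_set_letter _ _ _ _ _ uS hl zS).
Qed.

End Surjectivity.

(** * Images of multilinear polynomials *)

Section Images.
Variables (K : fieldType) (n : nat).
Hypothesis K_infinite : infinite_field K.
Implicit Types (M : 'M[K]_n.+1) (S : seq nat) (l : seq (K * seq nat)).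

Lemma multilinear_word_sum m (f : freealg K) : multilinear m f ->
  exists2 l, words_on (iota 0 m) l & f = word_sum l.
Proof.
case=> alpha ->; pose word (s : 'S_m) := [seq val (s i) | i <- index_enum 'I_m].
exists [seq (alpha s, word s) | s <- index_enum {perm 'I_m}].
  move=> _ /mapP[s _ ->] /=; apply: uniq_perm; rewrite ?iota_uniq //.
    rewrite map_inj_uniq ?index_enum_uniq // => i j /val_inj; exact: perm_inj.
  move=> i; rewrite mem_iota add0n; apply/mapP/idP => [[j _ ->]|lt_im].
    exact: ltn_ord.
  by exists (s^-1 (Ordinal lt_im))%g; rewrite ?mem_index_enum ?permKV.
rewrite /word_sum big_map; apply: eq_bigr => s _; congr (_ *: _).
by rewrite /word big_map.
Qed.

Lemma image_sub r (f : freealg K) M :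
  in_commutator_T_ideal r f -> UT_image f M -> M \in unit_span K n r.
Proof. by move=> hf [a [ha ->]]; apply: feval_commutator_T_ideal. Qed.

Lemma unit_span_lt r s : (r < s)%N -> (r <= n)%N ->
  exists2 M, M \in unit_span K n r & M \notin unit_span K n s.
Proof.
move=> lt_rs le_rn; pose j : 'I_n.+1 := Ordinal (le_rn : (r < n.+1)%N).
exists (delta_mx ord0 j).
  apply/mem_unit_span => a b lt_b; rewrite mxE.
  case: eqP => [ea|//]; case: eqP => [eb|//].
  by rewrite ea eb /= add0n ltnn in lt_b.
apply/negP => /mem_unit_span/(_ ord0 j); rewrite /= add0n => /(_ lt_rs).
by rewrite mxE !eqxx => /eqP; rewrite oner_eq0.
Qed.

(** A substitution by diagonal matrices multiplies the sum of the coefficients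
    of f by a constant, so this sum is nonzero; then all matrices but one can
    be set to 1. *)
Lemma image_degree0 S l e t M : uniq S -> S != [::] -> words_on S l ->
    \sum_(s <- S) e s = 0%N -> value e t 0 l != 0 ->
  M \in unit_span K n 0 -> UT_image (word_sum l) M.
Proof.
case: S => [//|z S] uS _ hl /eqP; rewrite sum_nat_seq_eq0 => /allP e0 v0 hM.
pose c0 := \sum_(c <- l) c.1.
have c0_neq0 : c0 != 0.
  apply: contraNneq v0 => c00; pose t0 := \prod_(s <- z :: S) t s 0%N.
  apply/eqP; transitivity (c0 * t0); last by rewrite c00 mul0r.
  rewrite mulr_suml; apply: eq_big_seq => c cl; rewrite weight_diag.
    by rewrite (perm_big _ (hl c cl)).
  by move=> s; rewrite (perm_mem (hl c cl)) => /e0/eqP.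
exists (set_letter z (c0^-1 *: M) (fun=> 1)); split.
  move=> s; rewrite /set_letter; case: (s == z); last exact: unit_span1.
  by rewrite memvZ.
rewrite feval_word_sum; transitivity (\sum_(c <- l) c.1 *: (c0^-1 *: M)).
  by rewrite -scaler_suml scalerA mulfV ?scale1r.
apply: eq_big_seq => -[x w] /= cl; congr (_ *: _).
have zw : z \in w by rewrite (perm_mem (hl _ cl)) mem_head.
have uw : uniq w by rewrite (perm_uniq (hl _ cl)).
case/splitPr: zw uw {cl} => u v uw.
by rewrite prod_set_letter // !big1 // mul1r mulr1.
Qed.

(** Some homogeneous substitution with at most d steps gives a nonzero value,
    and it has d steps because f takes its values in the d-th power of the
    radical. Let z be the letter that makes the first step. A single generic
    choice of coefficients for the other letters makes every diagonal
    coefficient of the triangular system nonzero. *)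
Lemma image_full S l d M : uniq S -> S != [::] -> words_on S l -> (d <= n)%N ->
    in_commutator_T_ideal d (word_sum l) ->
    ~ in_commutator_T_ideal d.+1 (word_sum l) ->
  M \in unit_span K n d -> UT_image (word_sum l) M.
Proof.
move=> uS S0 hl le_dn Td nTd hM.
have [e [t [le_d v0]]] : exists e t,
    (\sum_(s <- S) e s <= d)%N /\ value e t 0 l != 0.
  apply: NNPP => none; apply: nTd; apply: comm_power_T_ideal.
  apply: (low_vanish_comm_power uS hl) => e t lt_d; apply/eqP.
  by apply: contraT => v0; case: none; exists e, t.
have Ed : (\sum_(s <- S) e s)%N = d.
  apply/eqP; rewrite eqn_leq le_d leqNgt; apply/negP => lt_d.
  pose j : 'I_n.+1 := Ordinal (leq_ltn_trans le_d (le_dn : (d < n.+1)%N)).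
  have := feval_commutator_T_ideal Td (fun s => step_mx_UT n e t s).
  move/mem_unit_span/(_ ord0 j lt_d)/eqP.
  by rewrite (feval_step_mx _ _ _ _ hl) /= eqxx mulr1n (negbTE v0).
have [d0|d_gt0] := posnP d.
  by rewrite d0 in Ed hM; apply: image_degree0 Ed v0 hM.
rewrite -Ed in d_gt0 hM.
have [z [zS ez nz]] := value_first uS hl d_gt0 v0.
set dS := (\sum_(s <- S) e s)%N in hM.
pose val_at (ij : 'I_n.+1 * 'I_n.+1) T :=
  value (jump_step e z (ij.2 - (ij.1 + dS))) (jump_coef z T ij.1) ij.1 l.
have nz_at ij : exists T, val_at ij T != 0.
  have [T ET] := value_jump t (ij.2 - (ij.1 + dS)) ij.1 uS zS ez hl.
  by exists T; rewrite /val_at ET.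
have [T hT] := line_poly_common K_infinite (r := enum predT)
  (fun ij => line_poly_value _ _ _ _ _ _ : line_poly (val_at ij))
  (fun ij _ => nz_at ij).
apply: (@jump_image _ _ S l e T z) hM => // i j _.
by apply: (hT (i, j)); rewrite mem_enum.
Qed.

End Images.

Lemma commutator_degree_below (K : fieldType) (f : freealg K) r :
  ~ in_commutator_T_ideal r f -> exists2 d, (d < r)%N &
    in_commutator_T_ideal d f /\ ~ in_commutator_T_ideal d.+1 f.
Proof.
elim: r => [|r IHr] nTr; first by case: nTr; apply: (in_commutator_T_ideal0 f).
have [Tr|/IHr[d lt_d Td]] := classic (in_commutator_T_ideal r f).
  by exists r.
by exists d => //; apply: leqW.
Qed.

Theorem theorem4p3 (K : fieldType) (K_infinite : infinite_field K)
    (n m r : nat) (m_gt0 : (0 < m)%N)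
    (f : freealg K) (f_multilinear : multilinear m f) :
  ((r < n.+1)%N ->
     ((forall M : 'M[K]_n.+1, UT_image f M <-> M \in UT_rad_pow K n r)
      <-> commutator_degree r f))
  /\
  (r = n.+1 -> commutator_degree r f ->
     (forall M : 'M[K]_n.+1, UT_image f M <-> M \in UT_rad_pow K n r)).
Proof.
have [l hl Ef] := multilinear_word_sum f_multilinear.
have uS := iota_uniq 0 m.
have S0 : iota 0 m != [::] by case: m m_gt0 {f_multilinear hl uS}.
have image_degree d : (d <= n)%N -> in_commutator_T_ideal d f ->
    ~ in_commutator_T_ideal d.+1 f ->
    forall M : 'M[K]_n.+1, UT_image f M <-> M \in unit_span K n d.
  move=> le_dn Td nTd M; split; first exact: image_sub.
  rewrite Ef in Td nTd *.
  exact: (image_full K_infinite uS S0 hl le_dn Td nTd).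
have in_ideal : commutator_degree r f -> in_commutator_T_ideal r f.
  by case: (r) => [_|r' [h _]]; [apply: in_commutator_T_ideal0 | apply: h].
split=> [lt_rn|Er degr M]; last first.
  rewrite UT_rad_powE; split; first exact: (image_sub (in_ideal degr)).
  move=> /mem_unit_span hM; exists (fun=> 0); split=> [i|]; first exact: mem0v.
  have -> : M = 0.
    apply/matrixP => i j; rewrite mxE hM // Er.
    exact: leq_trans (ltn_ord j) (leq_addl _ _).
  rewrite Ef feval_word_sum big1_seq // => -[c w] /= /hl /perm_mem /=.
  case: w => [/(_ 0%N)|s w _]; first by rewrite mem_iota m_gt0.
  by rewrite big_cons mul0r scaler0.
split=> [im|degr M]; last first.
  rewrite UT_rad_powE; apply: image_degree => //; first exact: in_ideal.
  by case: degr.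
have {}im (M : 'M[K]_n.+1) : UT_image f M <-> M \in unit_span K n r.
  by rewrite -UT_rad_powE.
split=> [_|Tr1]; last first.
  have [M Mr /negP[]] := unit_span_lt K (ltnSn r) (lt_rn : (r <= n)%N).
  by apply: (image_sub Tr1); apply/im.
apply: NNPP => /commutator_degree_below[d lt_dr [Td nTd]].
have le_dn : (d <= n)%N by rewrite -ltnS (ltn_trans lt_dr).
have [M Md /negP[]] := unit_span_lt K lt_dr le_dn.
by apply/im/(image_degree d).
Qed.
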